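(* If $\Omega$ is a row-finite quasi-product with quasi-factor $\Lambda$ and stable quasi-factor $\Gamma$, then for any $q\in G(\Gamma)^*$, the map $q_\vartriangleleft$ induces a $k_1$-graph isomorphism $\widehat q_\vartriangleleft:\Omega_1^{r(q)}\to\Omega_1^{s(q)}$. If $\Gamma$ is connected, then for all $v,w\in\Gamma^0$ we have $\Omega_1^v\cong\Omega_1^w\cong\Lambda$ as $k_1$-graphs.
   Context: Conventions: $\mathbb N=\{0,1,2,\dots\}$ and $e_1,\dots,e_k$ is the standard basis of $\mathbb N^k$. A $k$-graph is a countable category $\Lambda$ (objects identified with identity morphisms) with a functor $d:\Lambda\to\mathbb N^k$ such that whenever $d(\lambda)=m+n$ there are unique $\mu,\nu\in\Lambda$ with $\lambda=\mu\nu$, $d(\mu)=m$, $d(\nu)=n$. Write $\Lambda^0=d^{-1}(0)$, and $r(\lambda),s(\lambda)$ for range and source; $\mu\nu$ is defined when $s(\mu)=r(\nu)$. Isomorphisms of $k$-graphs are bijective degree-preserving functors. $\Lambda$ is row-finite if $\{\lambda: r(\lambda)=v,\ d(\lambda)=n\}$ is finite for all $v\in\Lambda^0$, $n\in\mathbb N^k$. The one-skeleton $G(\Lambda)$ is the edge-colored directed graph with vertex set $\Lambda^0$, edge set $\{\lambda: d(\lambda)\in\{e_1,\dots,e_k\}\}$, source and range inherited from $\Lambda$, and $d(e)$ as the color of $e$. $\Lambda$ is connected if the undirected graph underlying $G(\Lambda)$ is connected. Isomorphisms of edge-colored directed graphs preserve source, range and color. For a directed graph $G$, $G^*$ is its category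 of finite paths $p_1\cdots p_n$ with $s(p_i)=r(p_{i+1})$ (vertices are paths of length $0$). The color order of $p_1\cdots p_n$ is $(d(p_1),\dots,d(p_n))$. Two paths in $G(\Lambda)^*$ are equivalent if they have the same composite in $\Lambda$; $[p]$ denotes the class (composite) of $p$. By the factorization property, for each path $p$ and each permutation of its color order there is exactly one path equivalent to $p$ with that color order. If $\Lambda$ is a $k_1$-graph and $\Gamma$ a $k_2$-graph, $\Lambda\times\Gamma$ is the product $(k_1+k_2)$-graph with degree $(d_\Lambda,d_\Gamma)$. Its one-skeleton has vertices $\Lambda^0\times\Gamma^0$ and edges $(e,v)$ ($e$ an edge of $G(\Lambda)$, $v\in\Gamma^0$; colored as $e$) and $(x,f)$ ($x\in\Lambda^0$, $f$ an edge of $G(\Gamma)$; colored $e_{k_1+j}$ if $f$ has color $e_j$), with source and range computed coordinatewise. A $(k_1+k_2)$-graph $\Omega$ is a quasi-product with quasi-factors $\Lambda$ (a $k_1$-graph) and $\Gamma$ (a $k_2$-graph) if: (i) $G(\Omega)\cong G(\Lambda\times\Gamma)$; (ii) there are injective functors $\psi_1:\Lambda\to\Omega$ and $\psi_2:\Gamma\to\Omega$; (iii) $d_\Lambda=\pi_1 d_\Omega\psi_1$ and $d_\Gamma=\pi_2d_\Omega\psi_2$, where $\pi_i:\mathbb N^{k_1}\times\mathbb N^{k_2}\to\mathbb N^{k_i}$ are the projections. One fixes the identification $G(\Omega)=G(\Lambda\times\Gamma)$ and labels edges and paths of $G(\Omega)$ accordingly. Put $\Omega_1=d^{-1}(\mathbb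 N^{k_1}\times\{0\})$, $\Omega_2=d^{-1}(\{0\}\times\mathbb N^{k_2})$. Then $\Omega_1=\bigsqcup_{w\in\Gamma^0}\Omega_1^w\times\{w\}$ and $\Omega_2=\bigsqcup_{x\in\Lambda^0}\{x\}\times\Omega_2^x$, where $\Omega_1^w\times\{w\}$ (resp. $\{x\}\times\Omega_2^x$) is the $k_1$-graph (resp. $k_2$-graph) of all elements of $\Omega$ represented by paths in $G(\Lambda)\times\{w\}$ (resp. $\{x\}\times G(\Gamma)$). For $p\in G(\Lambda)^*$, $([p],w)$ denotes the element of $\Omega_1^w\times\{w\}$ represented by the path $(p,w)$, and $[p]_w\in\Omega_1^w$ the corresponding element; similarly $(x,[q])$ for $q\in G(\Gamma)^*$. Conditions (ii)-(iii) in the definition of quasi-product are understood to guarantee that there are $w_0\in\Gamma^0$ and $x_0\in\Lambda^0$ with $\Omega_1^{w_0}\cong\Lambda$ and $\Omega_2^{x_0}\cong\Gamma$ as $k_1$- and $k_2$-graphs, respectively. Given $p\in G(\Lambda)^*$ and $q\in G(\Gamma)^*$, the element $([p],r(q))(s(p),[q])\in\Omega$ factors uniquely as $\beta\alpha$ with $\beta\in\Omega_2$, $\alpha\in\Omega_1$. Here $d(\beta)=d(s(p),[q])$, $d(\alpha)=d([p],r(q))$, $\beta\in\{r(p)\}\times\Omega_2^{r(p)}$ and $\alpha\in\Omega_1^{s(q)}\times\{s(q)\}$. Define $p_\vartriangleright(q)\in G(\Gamma)^*$ to be the unique path with the same color order as $q$ such that $(r(p),[p_\vartriangleright(q)])=\beta$,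 and $q_\vartriangleleft(p)\in G(\Lambda)^*$ to be the unique path with the same color order as $p$ such that $([q_\vartriangleleft(p)],s(q))=\alpha$. The maps $p_\vartriangleright:G(\Gamma)^*\to G(\Gamma)^*$ and $q_\vartriangleleft:G(\Lambda)^*\to G(\Lambda)^*$ preserve color order, source and range. The induced map is $\widehat q_\vartriangleleft([p]_{r(q)})=[q_\vartriangleleft(p)]_{s(q)}$. $\Gamma$ is a stable quasi-factor of $\Omega$ if $p_\vartriangleright=\mathrm{id}$ on $G(\Gamma)^*$ for all $p\in G(\Lambda)^*$. *)

(* Defs.v *)
From mathcomp Require Import all_boot all_algebra.
From mathcomp Require Import boolp classical_sets functions cardinality.
From Stdlib Require Import Relation_Operators.

Set Implicit Arguments.
Unset Strict Implicit.
Unset Printing Implicit Defensive.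

Import GRing.Theory.
Local Open Scope ring_scope.

(* [cmp l m] is the composite "l after m" and is meaningful only when
   [sr l = rg m]; every law below is guarded accordingly, so its value on
   non-composable pairs is never used. *)
Record category := Category {
  obj : Type;
  mor :> Type;
  idm : obj -> mor;
  rg : mor -> obj;
  sr : mor -> obj;
  cmp : mor -> mor -> mor;
  rg_id : forall v, rg (idm v) = v;
  sr_id : forall v, sr (idm v) = v;
  rg_cmp : forall l m, sr l = rg m -> rg (cmp l m) = rg l;
  sr_cmp : forall l m, sr l = rg m -> sr (cmp l m) = sr m;
  cmp_idl : forall l, cmp (idm (rg l)) l = l;
  cmp_idr : forall l, cmp l (idm (sr l)) = l;
  cmpA : forall l m n, sr l = rg m -> sr m = rg n ->
    cmp l (cmp m n) = cmp (cmp l m) n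
}.

Record functor (C D : category) := Functor {
  fobj : obj C -> obj D;
  fmor :> mor C -> mor D;
  functor_rg : forall l, rg (fmor l) = fobj (rg l);
  functor_sr : forall l, sr (fmor l) = fobj (sr l);
  functor_id : forall v, fmor (idm v) = idm (fobj v);
  functor_cmp : forall l m, sr l = rg m ->
    fmor (cmp l m) = cmp (fmor l) (fmor m)
}.

(* The monoid N^k is ['rV[nat]_k], with standard basis [delta_mx 0 i]. *)
Record kgraph (k : nat) := KGraph {
  kcat :> category;
  mor_countable : countable [set: mor kcat];
  deg : kcat -> 'rV[nat]_k;
  deg_id : forall v : obj kcat, deg (idm v) = 0;
  deg_cmp : forall l m : kcat, sr l = rg m -> deg (cmp l m) = deg l + deg m;
  factorization : forall (l : kcat) (m n : 'rV[nat]_k), deg l = m + n ->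
    exists! p : kcat * kcat,
      [/\ sr p.1 = rg p.2, cmp p.1 p.2 = l, deg p.1 = m & deg p.2 = n]
}.

(* Bijectivity on morphisms entails bijectivity on objects, since objects are
   identified with their identity morphisms. *)
Definition is_kgraph_iso k (L G : kgraph k) (F : functor L G) : Prop :=
  bijective F /\ forall l, deg (F l) = deg l.

Definition kgraph_isomorphic k (L G : kgraph k) : Prop :=
  exists F : functor L G, is_kgraph_iso F.

Definition row_finite k (L : kgraph k) : Prop :=
  forall (v : obj L) (n : 'rV[nat]_k),
    finite_set [set l : L | rg l = v /\ deg l = n].

Record cdigraph (C : Type) := CDigraph {
  vertex : Type;
  edge : Type;
  esrc : edge -> vertex;
  erng : edge -> vertex;
  color : edge -> C
}.

(* Graph morphisms; colors are not required to be preserved (the two color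
   sets may differ). *)
Record graph_hom C D (G : cdigraph C) (H : cdigraph D) := GraphHom {
  gvtx : vertex G -> vertex H;
  gedge : edge G -> edge H;
  gedge_src : forall e, esrc (gedge e) = gvtx (esrc e);
  gedge_rng : forall e, erng (gedge e) = gvtx (erng e)
}.

Definition graph_comp B C D (G : cdigraph B) (H : cdigraph C) (K : cdigraph D)
  (g : graph_hom H K) (f : graph_hom G H) : graph_hom G K :=
  @GraphHom _ _ G K (gvtx g \o gvtx f) (gedge g \o gedge f)
    (fun e => etrans (gedge_src g (gedge f e)) (congr1 (gvtx g) (gedge_src f e)))
    (fun e => etrans (gedge_rng g (gedge f e)) (congr1 (gvtx g) (gedge_rng f e))).

Record cdigraph_iso C (G H : cdigraph C) := CDigraphIso {
  ghom :> graph_hom G H;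
  gvtx_bij : bijective (gvtx ghom);
  gedge_bij : bijective (gedge ghom);
  gcolor : forall e, color (gedge ghom e) = color e
}.

Definition digraph_connected C (G : cdigraph C) : Prop :=
  forall v w : vertex G,
    clos_refl_sym_trans _ (fun x y => exists e, erng e = x /\ esrc e = y) v w.

(* Finite paths p_1 ... p_n with s(p_i) = r(p_(i+1)): the range and the list of
   edges (the range is needed for paths of length 0). *)
Fixpoint is_path C (G : cdigraph C) (v : vertex G) (es : seq (edge G)) : Prop :=
  if es is e :: es' then erng e = v /\ is_path (esrc e) es' else True.

Record gpath C (G : cdigraph C) := GPath {
  prng : vertex G;
  pedges : seq (edge G);
  pvalid : is_path prng pedges
}.

Definition psrc C (G : cdigraph C) (p : gpath G) : vertex G :=
  last (prng p) (map (@esrc _ G) (pedges p)).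

Definition color_order C (G : cdigraph C) (p : gpath G) : seq C :=
  map (@color _ G) (pedges p).

Lemma is_path_map C D (G : cdigraph C) (H : cdigraph D) (f : graph_hom G H) v es :
  is_path v es -> is_path (gvtx f v) (map (gedge f) es).
Proof.
elim: es v => //= e es IH v [<- /IH h].
by rewrite gedge_rng gedge_src.
Qed.

Definition path_map C D (G : cdigraph C) (H : cdigraph D) (f : graph_hom G H)
  (p : gpath G) : gpath H := GPath (is_path_map f (pvalid p)).

Lemma gpath_eq C (G : cdigraph C) (p q : gpath G) :
  prng p = prng q -> pedges p = pedges q -> p = q.
Proof.
case: p q => [v s hp] [w t hq] /= evw est; subst w t.
by rewrite (Prop_irrelevance hp hq).
Qed.

Lemma sig_inj T (P : T -> Prop) (x y : {x | P x}) : sval x = sval y -> x = y.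
Proof.
by case: x y => [a p] [b q] /= e; subst b; rewrite (Prop_irrelevance p q).
Qed.

Definition is_basis_vector k (n : 'rV[nat]_k) : Prop :=
  exists i : 'I_k, n = delta_mx 0 i.

Definition skeleton k (L : kgraph k) : cdigraph 'rV[nat]_k :=
  @CDigraph _ (obj L) {l : L | is_basis_vector (deg l)}
    (fun e => sr (sval e)) (fun e => rg (sval e)) (fun e => deg (sval e)).

Definition connected k (L : kgraph k) : Prop := digraph_connected (skeleton L).

Lemma degree0 k (K : kgraph k) (l : K) : deg l = 0 -> l = idm (rg l).
Proof.
move=> hd; have h0 : deg l = 0 + 0 by rewrite hd addr0.
have [pq [_ u]] := factorization h0.
have := u (idm (rg l), l); rewrite /= sr_id cmp_idl deg_id hd => /(_ (And4 _ _ _ _)).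
move=> /(_ erefl erefl erefl erefl) e1.
have := u (l, idm (sr l)); rewrite /= rg_id cmp_idr deg_id hd => /(_ (And4 _ _ _ _)).
by move=> /(_ erefl erefl erefl erefl) e2; move: e1; rewrite e2 => -[].
Qed.

(* The composite in L of a path of the one-skeleton, i.e. its class [p]. *)
Definition composite k (L : kgraph k) (p : gpath (skeleton L)) : L :=
  foldr (fun e m => cmp (sval e) m) (idm (psrc p)) (pedges p).

Section Product.
Variables (k1 k2 : nat) (L : kgraph k1) (G : kgraph k2).

Definition prod_category : category.
Proof.
refine (@Category (obj L * obj G) (L * G)
  (fun v => (idm v.1, idm v.2)) (fun l => (rg l.1, rg l.2))
  (fun l => (sr l.1, sr l.2)) (fun l m => (cmp l.1 m.1, cmp l.2 m.2))
  _ _ _ _ _ _ _).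
- by case=> v w /=; rewrite !rg_id.
- by case=> v w /=; rewrite !sr_id.
- by case=> [a b] [c d] /= [h1 h2]; rewrite !rg_cmp.
- by case=> [a b] [c d] /= [h1 h2]; rewrite !sr_cmp.
- by case=> a b /=; rewrite !cmp_idl.
- by case=> a b /=; rewrite !cmp_idr.
- by case=> [a b] [c d] [e f] /= [h1 h2] [h3 h4]; rewrite !cmpA.
Defined.

Definition prod_kgraph : kgraph (k1 + k2).
Proof.
refine (@KGraph (k1 + k2) prod_category _ (fun l => row_mx (deg l.1) (deg l.2))
  _ _ _).
- have -> : ([set: mor prod_category] = [set: L] `*` [set: G])%classic.
    by apply/seteqP; split.
  by apply: countableX; exact: mor_countable.
- by move=> v /=; rewrite !deg_id row_mx0.
- by case=> [a b] [c d] /= [h1 h2]; rewrite !deg_cmp // add_row_mx.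
- case=> a b m n /= h.
  move: h; rewrite -(hsubmxK m) -(hsubmxK n) add_row_mx => /eq_row_mx [h1 h2].
  have [[a1 a2] [/= [sa ca da1 da2] ua]] := factorization h1.
  have [[b1 b2] [/= [sb cb db1 db2] ub]] := factorization h2.
  exists ((a1, b1), (a2, b2)); split => /=.
    by split; rewrite ?sa ?sb ?ca ?cb ?da1 ?da2 ?db1 ?db2.
  case=> [[x1 y1] [x2 y2]] /= [[s1 s2] [c1 c2] /eq_row_mx [d1 d2] /eq_row_mx [d3 d4]].
  have /= [-> ->] := ua (x1, x2) (And4 s1 c1 d1 d3).
  by have /= [-> ->] := ub (y1, y2) (And4 s2 c2 d2 d4).
Defined.

Lemma slice1_deg (e : edge (skeleton L)) (w : obj G) :
  is_basis_vector (@deg _ prod_kgraph (sval e, idm w)).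
Proof.
case: e => l [i /= hi]; exists (lshift k2 i) => /=.
by rewrite hi deg_id delta_mx_lshift.
Qed.

Lemma slice2_deg (x : obj L) (f : edge (skeleton G)) :
  is_basis_vector (@deg _ prod_kgraph (idm x, sval f)).
Proof.
case: f => l [i /= hi]; exists (rshift k1 i) => /=.
by rewrite hi deg_id delta_mx_rshift.
Qed.

(* p |-> (p, w) and q |-> (x, q). *)
Definition slice1 (w : obj G) : graph_hom (skeleton L) (skeleton prod_kgraph).
Proof.
refine (@GraphHom _ _ (skeleton L) (skeleton prod_kgraph) (fun x => (x, w))
  (fun e => exist _ (sval e, idm w) (slice1_deg e w)) _ _).
- by move=> e /=; rewrite sr_id.
- by move=> e /=; rewrite rg_id.
Defined.

Definition slice2 (x : obj L) : graph_hom (skeleton G) (skeleton prod_kgraph).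
Proof.
refine (@GraphHom _ _ (skeleton G) (skeleton prod_kgraph) (fun w => (x, w))
  (fun f => exist _ (idm x, sval f) (slice2_deg x f)) _ _).
- by move=> f /=; rewrite sr_id.
- by move=> f /=; rewrite rg_id.
Defined.

End Product.

Lemma basis_decomposition k (c : 'rV[nat]_k) :
  exists2 cs : seq 'rV[nat]_k,
    (forall x, x \in cs -> is_basis_vector x) & \sum_(x <- cs) x = c.
Proof.
pose Q (c : 'rV[nat]_k) := exists2 cs : seq 'rV[nat]_k,
  (forall x, x \in cs -> is_basis_vector x) & \sum_(x <- cs) x = c.
have Q0 : Q 0 by exists [::] => //; rewrite big_nil.
have QD a b : Q a -> Q b -> Q (a + b).
  move=> [s hs <-] [t ht <-]; exists (s ++ t); last by rewrite big_cat.
  by move=> x; rewrite mem_cat => /orP [/hs|/ht].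
have QM i n : Q (delta_mx 0 i *+ n).
  elim: n => [|n IH]; first by rewrite mulr0n.
  rewrite mulrS; apply: QD => //; exists [:: delta_mx 0 i].
    by move=> x; rewrite inE => /eqP ->; exists i.
  by rewrite big_seq1.
suff -> : c = \sum_i delta_mx 0 i *+ c 0 i by apply: (big_ind Q).
apply/rowP => j; rewrite summxE (bigD1 j) //= big1 ?addr0 => [|i ij].
  by rewrite mulmxnE mxE !eqxx; exact/esym/natn.
by rewrite mulmxnE mxE eq_sym (negbTE ij) andbF mul0rn.
Qed.

(* If every edge of G(Om) of color [iota c] whose range is in the image of H
   is the image of an edge of H, then so is every path with colors in the image
   of iota. *)
Section Leg.
Variables (k k' : nat) (Om : kgraph k) (H : cdigraph 'rV[nat]_k').
Variables (f : graph_hom H (skeleton Om)) (iota : 'rV[nat]_k' -> 'rV[nat]_k).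
Hypothesis iota0 : iota 0 = 0.
Hypothesis iotaD : forall a b, iota (a + b) = iota a + iota b.
Hypothesis iotaI : injective iota.
Hypothesis fvI : injective (gvtx f).
Hypothesis feI : injective (gedge f).
Hypothesis fcolor : forall e, color (gedge f e) = iota (color e).
Hypothesis flift : forall c (l : edge (skeleton Om)) x,
  is_basis_vector c -> color l = iota c -> erng l = gvtx f x ->
  exists e, gedge f e = l.
Hypothesis iota_basis : forall c, is_basis_vector c -> is_basis_vector (iota c).

Let cl x es := foldr (fun e (m : Om) => cmp (sval e) m)
  (idm (gvtx f (last x (map (@esrc _ H) es)))) (map (gedge f) es).

Lemma composite_leg (p : gpath H) :
  composite (path_map f p) = cl (prng p) (pedges p).
Proof.
rewrite /composite /cl /psrc /=; congr (foldr _ (idm _) _).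
rewrite -map_comp -(last_map (gvtx f)) -map_comp; congr (last _ _).
by apply: eq_map => e /=; have := gedge_src f e.
Qed.

Lemma leg_ends x es : is_path x es ->
  [/\ rg (cl x es) = gvtx f x,
      sr (cl x es) = gvtx f (last x (map (@esrc _ H) es)) &
      deg (cl x es) = iota (\sum_(c <- map (@color _ H) es) c)].
Proof.
elim: es x => [|e es IH] x /=.
  by move=> _; rewrite /cl /= rg_id sr_id deg_id big_nil iota0.
move=> [er /IH [h1 h2 h3]].
have E : cl x (e :: es) = cmp (sval (gedge f e)) (cl (esrc e) es) by [].
have sE : sr (sval (gedge f e)) = gvtx f (esrc e) := gedge_src f e.
have rE : rg (sval (gedge f e)) = gvtx f (erng e) := gedge_rng f e.
have dE : deg (sval (gedge f e)) = iota (color e) := fcolor e.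
rewrite E rg_cmp ?sr_cmp ?deg_cmp ?sE ?h1 //.
by rewrite rE er h2 h3 big_cons iotaD dE.
Qed.

Lemma leg_exists cs (l : Om) x : (forall c, c \in cs -> is_basis_vector c) ->
  deg l = iota (\sum_(c <- cs) c) -> rg l = gvtx f x ->
  exists p : gpath H, [/\ prng p = x, color_order p = cs &
    composite (path_map f p) = l].
Proof.
move=> hcs hd hr.
suff [es [h1 h2 h3]] : exists es, [/\ is_path x es, map (@color _ H) es = cs & cl x es = l].
  by exists (GPath h1); split => //; rewrite composite_leg.
elim: cs l x hcs hd hr => [|c cs IH] l x hcs.
  rewrite big_nil iota0 => hd hr; exists [::]; split => //; rewrite /cl /=.
  by rewrite -hr -(degree0 hd).
rewrite big_cons iotaD => hd hr.
have [[a b] [/= [sab cab da db] _]] := factorization hd.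
have hc : is_basis_vector c by apply: hcs; rewrite mem_head.
have ha : is_basis_vector (deg a) by rewrite da; exact: iota_basis.
pose ea : edge (skeleton Om) := exist _ a ha.
have ra : rg a = gvtx f x by rewrite -hr -cab rg_cmp.
have [e he] := @flift c ea x hc da ra.
have sa : sr a = gvtx f (esrc e).
  by have := gedge_src f e; rewrite he.
have hcs' y : y \in cs -> is_basis_vector y.
  by move=> hy; apply: hcs; rewrite inE hy orbT.
have [es [h1 h2 h3]] := IH b (esrc e) hcs' db (etrans (esym sab) sa).
have hx : erng e = x by apply: fvI; rewrite -(gedge_rng f) he.
exists (e :: es); split => //=.
- by rewrite h2; congr (_ :: _); apply: iotaI; rewrite -fcolor he.
- by rewrite -cab -h3 /cl /= he.
Qed.

Lemma leg_unique (p q : gpath H) : prng p = prng q ->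
  color_order p = color_order q ->
  composite (path_map f p) = composite (path_map f q) -> p = q.
Proof.
rewrite !composite_leg; case: p q => [x s hs] [y t ht] /= exy hc hcl.
subst y; apply: gpath_eq => //=; move: hc hcl; rewrite /color_order /=.
elim: s t x hs ht => [|e s IH] [|e' t] x //= [er hs] [er' ht] [ce cs] hcl.
have [_ _ ds] := leg_ends hs; have [_ _ dt] := leg_ends ht.
have [rs _ _] := leg_ends hs; have [rt _ _] := leg_ends ht.
have E a u : cl x (a :: u) = cmp (sval (gedge f a)) (cl (esrc a) u) by [].
move: hcl; rewrite !E => hcl.
have c1 : sr (sval (gedge f e)) = rg (cl (esrc e) s).
  by rewrite rs; exact: (gedge_src f e).
have c2 : sr (sval (gedge f e')) = rg (cl (esrc e') t).
  by rewrite rt; exact: (gedge_src f e').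
have [pq [_ u]] := factorization (deg_cmp c1).
have h1 := u (_, _) (And4 c1 erefl erefl erefl).
have d1 : deg (sval (gedge f e')) = deg (sval (gedge f e)).
  by have := fcolor e; have := fcolor e'; rewrite /= ce => -> ->.
have d2 : deg (cl (esrc e') t) = deg (cl (esrc e) s) by rewrite ds dt cs.
have h2 := u (_, _) (And4 c2 (esym hcl) d1 d2).
move: h2; rewrite h1 => -[ee ecl].
have {}ee : e = e'.
  by apply: feI; apply: sig_inj; rewrite ee.
subst e'; congr (_ :: _); exact: IH hs ht cs ecl.
Qed.

End Leg.

(* A subcategory (V, M) of a k-graph which is closed under factorizations and
   on which the degree is determined by its image under [pi : N^k -> N^k'] is a
   k'-graph with degree functor [pi \o deg]. *)
Section SubKGraph.
Variables (k k' : nat) (Om : kgraph k).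
Variables (pi : 'rV[nat]_k -> 'rV[nat]_k') (iota : 'rV[nat]_k' -> 'rV[nat]_k).
Variables (V : obj Om -> Prop) (M : Om -> Prop).
Hypothesis pi0 : pi 0 = 0.
Hypothesis piD : forall a b, pi (a + b) = pi a + pi b.
Hypothesis iotaD : forall a b, iota (a + b) = iota a + iota b.
Hypothesis iotaK : cancel iota pi.
Hypothesis M_deg : forall l, M l -> deg l = iota (pi (deg l)).
Hypothesis M_id : forall v, V v -> M (idm v).
Hypothesis M_rg : forall l, M l -> V (rg l).
Hypothesis M_sr : forall l, M l -> V (sr l).
Hypothesis M_cmp : forall l m, sr l = rg m -> M l -> M m -> M (cmp l m).
Hypothesis M_fact : forall l m, sr l = rg m -> M (cmp l m) -> M l /\ M m.

Definition sub_cmp (l m : {l | M l}) : {l | M l} :=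
  match pselect (sr (sval l) = rg (sval m)) with
  | left h => exist _ (cmp (sval l) (sval m)) (M_cmp h (svalP l) (svalP m))
  | right _ => l
  end.

Lemma sub_cmpE l m : sr (sval l) = rg (sval m) ->
  sval (sub_cmp l m) = cmp (sval l) (sval m).
Proof. by rewrite /sub_cmp; case: pselect. Qed.

Definition sub_category : category.
Proof.
refine (@Category {v | V v} {l | M l}
  (fun v => exist _ (idm (sval v)) (M_id (svalP v)))
  (fun l => exist _ (rg (sval l)) (M_rg (svalP l)))
  (fun l => exist _ (sr (sval l)) (M_sr (svalP l)))
  sub_cmp _ _ _ _ _ _ _).
- by move=> v; apply: sig_inj; rewrite /= rg_id.
- by move=> v; apply: sig_inj; rewrite /= sr_id.
- by move=> l m [h]; apply: sig_inj; rewrite /= sub_cmpE // rg_cmp.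
- by move=> l m [h]; apply: sig_inj; rewrite /= sub_cmpE // sr_cmp.
- by move=> l; apply: sig_inj; rewrite /= sub_cmpE /= ?sr_id // cmp_idl.
- by move=> l; apply: sig_inj; rewrite /= sub_cmpE /= ?rg_id // cmp_idr.
- move=> l m n [h1] [h2]; apply: sig_inj.
  by rewrite !sub_cmpE ?rg_cmp ?sr_cmp // cmpA.
Defined.

Definition sub_kgraph : kgraph k'.
Proof.
refine (@KGraph k' sub_category _ (fun l => pi (deg (sval l))) _ _ _).
- have /countable_injP [g gI] := mor_countable Om.
  apply/countable_injP; exists (g \o sval) => l m _ _ /= e.
  by apply: sig_inj; apply: gI; rewrite ?in_setT.
- by move=> v; rewrite /= deg_id.
- by move=> l m [h]; rewrite /= sub_cmpE // deg_cmp // piD.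
- move=> l m n /= h.
  have hd : deg (sval l) = iota m + iota n.
    by rewrite -iotaD -h -M_deg //; exact: svalP.
  have [[a b] [/= [sab cab da db] u]] := factorization hd.
  have [Ma Mb] : M a /\ M b by apply: M_fact => //; rewrite cab; exact: svalP.
  exists (exist _ a Ma, exist _ b Mb); split => /=.
    split; [exact: sig_inj| |by rewrite da iotaK|by rewrite db iotaK].
    by apply: sig_inj; rewrite sub_cmpE.
  case=> [[c Mc] [e Me]] /= [[s1] c1 d1 d2].
  have [] : (a, b) = (c, e).
    apply: u; split => //=; first by rewrite -c1 sub_cmpE.
      by rewrite -d1 -M_deg.
    by rewrite -d2 -M_deg.
  by move=> ea eb; congr (_, _); apply: sig_inj.
Defined.

End SubKGraph.

Section QuasiProductSkeleton.
Variables (k1 k2 : nat) (Om : kgraph (k1 + k2)) (L : kgraph k1) (G : kgraph k2).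
Variable phi : cdigraph_iso (skeleton (prod_kgraph L G)) (skeleton Om).

(* G(Om) is identified with G(L x G) along [phi]; [cls1 p w] is the element
   ([p], w) and [cls2 x q] the element (x, [q]) of Om. *)
Definition leg1 (w : obj G) : graph_hom (skeleton L) (skeleton Om) :=
  graph_comp phi (slice1 L w).
Definition leg2 (x : obj L) : graph_hom (skeleton G) (skeleton Om) :=
  graph_comp phi (slice2 G x).

Definition cls1 (p : gpath (skeleton L)) (w : obj G) : Om :=
  composite (path_map (leg1 w) p).
Definition cls2 (x : obj L) (q : gpath (skeleton G)) : Om :=
  composite (path_map (leg2 x) q).

Let iota1 (a : 'rV[nat]_k1) : 'rV[nat]_(k1 + k2) := row_mx a 0.
Let iota2 (b : 'rV[nat]_k2) : 'rV[nat]_(k1 + k2) := row_mx 0 b.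

Let iota1_0 : iota1 0 = 0. Proof. exact: row_mx0. Qed.
Let iota2_0 : iota2 0 = 0. Proof. exact: row_mx0. Qed.
Let iota1D a b : iota1 (a + b) = iota1 a + iota1 b.
Proof. by rewrite /iota1 add_row_mx addr0. Qed.
Let iota2D a b : iota2 (a + b) = iota2 a + iota2 b.
Proof. by rewrite /iota2 add_row_mx addr0. Qed.
Let iota1K : cancel iota1 (@lsubmx _ _ _ _).
Proof. by move=> a; exact: row_mxKl. Qed.
Let iota2K : cancel iota2 (@rsubmx _ _ _ _).
Proof. by move=> a; exact: row_mxKr. Qed.
Let iota1_basis c : is_basis_vector c -> is_basis_vector (iota1 c).
Proof. by case=> i ->; exists (lshift k2 i); rewrite delta_mx_lshift. Qed.
Let iota2_basis c : is_basis_vector c -> is_basis_vector (iota2 c).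
Proof. by case=> i ->; exists (rshift k1 i); rewrite delta_mx_rshift. Qed.

Lemma leg1_vI w : injective (gvtx (leg1 w)).
Proof. by move=> x y /= /(bij_inj (gvtx_bij phi)) []. Qed.
Lemma leg2_vI x : injective (gvtx (leg2 x)).
Proof. by move=> v w /= /(bij_inj (gvtx_bij phi)) []. Qed.
Lemma leg1_eI w : injective (gedge (leg1 w)).
Proof. by move=> e e' /= /(bij_inj (gedge_bij phi)) [h]; exact: sig_inj. Qed.
Lemma leg2_eI x : injective (gedge (leg2 x)).
Proof. by move=> e e' /= /(bij_inj (gedge_bij phi)) [h]; exact: sig_inj. Qed.
Lemma leg1_color w e : color (gedge (leg1 w) e) = row_mx (color e) 0.
Proof. by have := gcolor phi (gedge (slice1 L w) e); rewrite /= deg_id. Qed.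
Lemma leg2_color x e : color (gedge (leg2 x) e) = row_mx 0 (color e).
Proof. by have := gcolor phi (gedge (slice2 G x) e); rewrite /= deg_id. Qed.

Lemma leg1_lift w c (l : edge (skeleton Om)) x : is_basis_vector c ->
  color l = row_mx c 0 -> erng l = gvtx (leg1 w) x ->
  exists e, gedge (leg1 w) e = l.
Proof.
move=> hc cl rl; have [g _ gK] := gedge_bij phi.
case E: (g l) => [[a b] hab].
have := gcolor phi (g l); rewrite gK cl E /= => /eq_row_mx [ca /esym/degree0 eb].
have := gedge_rng phi (g l); rewrite gK rl E /=.
move/(bij_inj (gvtx_bij phi)) => [_ rb].
have ha : is_basis_vector (deg a) by rewrite -ca.
exists (exist _ a ha); rewrite -[l]gK /=; congr (gedge phi _).
by apply: sig_inj; rewrite E /= eb -rb.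
Qed.

Lemma leg2_lift x c (l : edge (skeleton Om)) w : is_basis_vector c ->
  color l = row_mx 0 c -> erng l = gvtx (leg2 x) w ->
  exists e, gedge (leg2 x) e = l.
Proof.
move=> hc cl rl; have [g _ gK] := gedge_bij phi.
case E: (g l) => [[a b] hab].
have := gcolor phi (g l); rewrite gK cl E /= => /eq_row_mx [/esym/degree0 ea cb].
have := gedge_rng phi (g l); rewrite gK rl E /=.
move/(bij_inj (gvtx_bij phi)) => [ra _].
have hb : is_basis_vector (deg b) by rewrite -cb.
exists (exist _ b hb); rewrite -[l]gK /=; congr (gedge phi _).
by apply: sig_inj; rewrite E /= ea -ra.
Qed.

Lemma cls1_ends p w : [/\ rg (cls1 p w) = gvtx phi (prng p, w),
  sr (cls1 p w) = gvtx phi (psrc p, w) &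
  deg (cls1 p w) = row_mx (\sum_(c <- color_order p) c) 0].
Proof.
rewrite /cls1 composite_leg.
exact: (leg_ends iota1_0 iota1D (@leg1_color w) (pvalid p)).
Qed.

Lemma cls2_ends x q : [/\ rg (cls2 x q) = gvtx phi (x, prng q),
  sr (cls2 x q) = gvtx phi (x, psrc q) &
  deg (cls2 x q) = row_mx 0 (\sum_(c <- color_order q) c)].
Proof.
rewrite /cls2 composite_leg.
exact: (leg_ends iota2_0 iota2D (@leg2_color x) (pvalid q)).
Qed.

Lemma cls1_exists cs (l : Om) x w : (forall c, c \in cs -> is_basis_vector c) ->
  deg l = row_mx (\sum_(c <- cs) c) 0 -> rg l = gvtx phi (x, w) ->
  exists p : gpath (skeleton L), [/\ prng p = x, color_order p = cs & cls1 p w = l].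
Proof.
exact: (leg_exists iota1_0 iota1D (can_inj iota1K) (@leg1_vI w) (@leg1_color w)
  (@leg1_lift w) iota1_basis).
Qed.

Lemma cls2_exists cs (l : Om) x w : (forall c, c \in cs -> is_basis_vector c) ->
  deg l = row_mx 0 (\sum_(c <- cs) c) -> rg l = gvtx phi (x, w) ->
  exists q : gpath (skeleton G), [/\ prng q = w, color_order q = cs & cls2 x q = l].
Proof.
exact: (leg_exists iota2_0 iota2D (can_inj iota2K) (@leg2_vI x) (@leg2_color x)
  (@leg2_lift x) iota2_basis).
Qed.

Lemma cls1_inj p p' w : color_order p = color_order p' ->
  cls1 p w = cls1 p' w -> p = p'.
Proof.
move=> hc hp; apply: (leg_unique iota1_0 iota1D (@leg1_eI w) (@leg1_color w)) => //.
have [r1 _ _] := cls1_ends p w; have [r2 _ _] := cls1_ends p' w.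
by apply: (@leg1_vI w); rewrite /= -r1 -r2 hp.
Qed.

Lemma cls2_inj q q' x : color_order q = color_order q' ->
  cls2 x q = cls2 x q' -> q = q'.
Proof.
move=> hc hq; apply: (leg_unique iota2_0 iota2D (@leg2_eI x) (@leg2_color x)) => //.
have [r1 _ _] := cls2_ends x q; have [r2 _ _] := cls2_ends x q'.
by apply: (@leg2_vI x); rewrite /= -r1 -r2 hq.
Qed.

(* The subcategories d^-1(N^k1 x 0) and d^-1(0 x N^k2) of Om. *)
Definition in_Omega1 (l : Om) : Prop := rsubmx (deg l) = 0.
Definition in_Omega2 (l : Om) : Prop := lsubmx (deg l) = 0.

Let in_Omega1P l : in_Omega1 l <-> deg l = row_mx (lsubmx (deg l)) 0.
Proof.
rewrite /in_Omega1 /in_Omega2; split=> [h|->]; last exact: row_mxKr.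
by rewrite -[LHS]hsubmxK h.
Qed.

Let in_Omega2P l : in_Omega2 l <-> deg l = row_mx 0 (rsubmx (deg l)).
Proof.
rewrite /in_Omega1 /in_Omega2; split=> [h|->]; last exact: row_mxKl.
by rewrite -[LHS]hsubmxK h.
Qed.

Definition Omega1_mor (w : obj G) (l : Om) : Prop := exists p, cls1 p w = l.
Definition Omega1_obj (w : obj G) (v : obj Om) : Prop :=
  exists x, v = gvtx phi (x, w).
Definition Omega2_mor (x : obj L) (l : Om) : Prop := exists q, cls2 x q = l.
Definition Omega2_obj (x : obj L) (v : obj Om) : Prop :=
  exists w, v = gvtx phi (x, w).

Lemma Omega1_morP w l : Omega1_mor w l <-> in_Omega1 l /\ Omega1_obj w (rg l).
Proof.
split=> [[p <-]|[/in_Omega1P hd [x hx]]].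
  have [-> _ hd] := cls1_ends p w.
  by split; [rewrite /in_Omega1 hd row_mxKr | exists (prng p)].
have [cs hcs hsum] := basis_decomposition (lsubmx (deg l)).
have hd' : deg l = row_mx (\sum_(c <- cs) c) 0 by rewrite hsum.
by have [p [_ _ hp]] := cls1_exists hcs hd' hx; exists p.
Qed.

Lemma Omega2_morP x l : Omega2_mor x l <-> in_Omega2 l /\ Omega2_obj x (rg l).
Proof.
split=> [[q <-]|[/in_Omega2P hd [w hw]]].
  have [-> _ hd] := cls2_ends x q.
  by split; [rewrite /in_Omega2 hd row_mxKl | exists (prng q)].
have [cs hcs hsum] := basis_decomposition (rsubmx (deg l)).
have hd' : deg l = row_mx 0 (\sum_(c <- cs) c) by rewrite hsum.
by have [q [_ _ hq]] := cls2_exists hcs hd' hw; exists q.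
Qed.

Let Omega1_sr w l : Omega1_mor w l -> Omega1_obj w (sr l).
Proof. by case=> p <-; have [_ -> _] := cls1_ends p w; exists (psrc p). Qed.
Let Omega2_sr x l : Omega2_mor x l -> Omega2_obj x (sr l).
Proof. by case=> q <-; have [_ -> _] := cls2_ends x q; exists (psrc q). Qed.

Let nat_vec_add0 k (a b : 'rV[nat]_k) : a + b = 0 -> a = 0 /\ b = 0.
Proof.
move=> h; have hi (i : 'I_k) : (a 0%R i + b 0%R i)%N = 0%N.
  by have := congr1 (fun c : 'rV[nat]_k => c 0 i) h; rewrite !mxE.
by split; apply/rowP => i; move/eqP: (hi i); rewrite addn_eq0 mxE => /andP [/eqP h1 /eqP h2].
Qed.

Let rsubD (a b : 'rV[nat]_(k1 + k2)) : rsubmx (a + b) = rsubmx a + rsubmx b.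
Proof. by apply/rowP => i; rewrite !mxE. Qed.
Let lsubD (a b : 'rV[nat]_(k1 + k2)) : lsubmx (a + b) = lsubmx a + lsubmx b.
Proof. by apply/rowP => i; rewrite !mxE. Qed.
Let rsub0 : rsubmx (0 : 'rV[nat]_(k1 + k2)) = 0.
Proof. by apply/rowP => i; rewrite !mxE. Qed.
Let lsub0 : lsubmx (0 : 'rV[nat]_(k1 + k2)) = 0.
Proof. by apply/rowP => i; rewrite !mxE. Qed.

Let Omega1_deg w l : Omega1_mor w l -> deg l = iota1 (lsubmx (deg l)).
Proof. by move/Omega1_morP => [/in_Omega1P]. Qed.
Let Omega2_deg x l : Omega2_mor x l -> deg l = iota2 (rsubmx (deg l)).
Proof. by move/Omega2_morP => [/in_Omega2P]. Qed.
Let Omega1_id w v : Omega1_obj w v -> Omega1_mor w (idm v).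
Proof.
by move=> h; apply/Omega1_morP; rewrite /in_Omega1 deg_id rg_id rsub0.
Qed.
Let Omega2_id x v : Omega2_obj x v -> Omega2_mor x (idm v).
Proof.
by move=> h; apply/Omega2_morP; rewrite /in_Omega2 deg_id rg_id lsub0.
Qed.
Let Omega1_rg w l : Omega1_mor w l -> Omega1_obj w (rg l).
Proof. by move/Omega1_morP => []. Qed.
Let Omega2_rg x l : Omega2_mor x l -> Omega2_obj x (rg l).
Proof. by move/Omega2_morP => []. Qed.
Let Omega1_cmp w l m : sr l = rg m -> Omega1_mor w l -> Omega1_mor w m ->
  Omega1_mor w (cmp l m).
Proof.
move=> h /Omega1_morP [hl1 hl2] /Omega1_morP [hm1 _]; apply/Omega1_morP.
by rewrite /in_Omega1 rg_cmp // deg_cmp // rsubD hl1 hm1 addr0.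
Qed.
Let Omega2_cmp x l m : sr l = rg m -> Omega2_mor x l -> Omega2_mor x m ->
  Omega2_mor x (cmp l m).
Proof.
move=> h /Omega2_morP [hl1 hl2] /Omega2_morP [hm1 _]; apply/Omega2_morP.
by rewrite /in_Omega2 rg_cmp // deg_cmp // lsubD hl1 hm1 addr0.
Qed.
Let Omega1_fact w l m : sr l = rg m -> Omega1_mor w (cmp l m) ->
  Omega1_mor w l /\ Omega1_mor w m.
Proof.
move=> h /Omega1_morP []; rewrite /in_Omega1 rg_cmp // deg_cmp // rsubD.
move=> /nat_vec_add0 [hl hm] hr.
have Ml : Omega1_mor w l by apply/Omega1_morP.
by split=> //; apply/Omega1_morP; rewrite -h; split=> //; exact: Omega1_sr.
Qed.
Let Omega2_fact x l m : sr l = rg m -> Omega2_mor x (cmp l m) ->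
  Omega2_mor x l /\ Omega2_mor x m.
Proof.
move=> h /Omega2_morP []; rewrite /in_Omega2 rg_cmp // deg_cmp // lsubD.
move=> /nat_vec_add0 [hl hm] hr.
have Ml : Omega2_mor x l by apply/Omega2_morP.
by split=> //; apply/Omega2_morP; rewrite -h; split=> //; exact: Omega2_sr.
Qed.

(* Omega_1^w x {w} and {x} x Omega_2^x; as the label w, resp. x, carries no
   information, they also stand for Omega_1^w and Omega_2^x. *)
Definition Omega1 (w : obj G) : kgraph k1 :=
  @sub_kgraph _ _ Om (@lsubmx _ _ _ _) iota1 (Omega1_obj w) (Omega1_mor w)
    lsub0 lsubD iota1D iota1K (@Omega1_deg w) (@Omega1_id w) (@Omega1_rg w)
    (@Omega1_sr w) (@Omega1_cmp w) (@Omega1_fact w).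

Definition Omega2 (x : obj L) : kgraph k2 :=
  @sub_kgraph _ _ Om (@rsubmx _ _ _ _) iota2 (Omega2_obj x) (Omega2_mor x)
    rsub0 rsubD iota2D iota2K (@Omega2_deg x) (@Omega2_id x) (@Omega2_rg x)
    (@Omega2_sr x) (@Omega2_cmp x) (@Omega2_fact x).

(* The element [p]_w of Omega_1^w. *)
Definition class1 (p : gpath (skeleton L)) (w : obj G) : Omega1 w :=
  exist _ (cls1 p w) (ex_intro _ p erefl).

(* ([p], r(q)) (s(p), [q]) *)
Definition corner (p : gpath (skeleton L)) (q : gpath (skeleton G)) : Om :=
  cmp (cls1 p (prng q)) (cls2 (psrc p) q).

Lemma corner_ends p q : [/\ rg (corner p q) = gvtx phi (prng p, prng q),
  sr (corner p q) = gvtx phi (psrc p, psrc q) &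
  deg (corner p q) = deg (cls2 (psrc p) q) + deg (cls1 p (prng q))].
Proof.
have [r1 s1 _] := cls1_ends p (prng q); have [r2 s2 _] := cls2_ends (psrc p) q.
by rewrite /corner rg_cmp ?sr_cmp ?deg_cmp ?s1 ?r2 // r1 s2 addrC.
Qed.

Lemma corner_factorization p q : exists! ba : Om * Om,
  [/\ sr ba.1 = rg ba.2, cmp ba.1 ba.2 = corner p q,
      in_Omega2 ba.1 & in_Omega1 ba.2].
Proof.
have [_ _ hd] := corner_ends p q.
have [ba [[h1 h2 h3 h4] u]] := factorization hd.
have [_ _ d1] := cls1_ends p (prng q); have [_ _ d2] := cls2_ends (psrc p) q.
exists ba; split.
  by split; rewrite // /in_Omega1 /in_Omega2 ?h3 ?h4 ?d1 ?d2 ?row_mxKl ?row_mxKr.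
case=> b a /= [s1 c1 /in_Omega2P db /in_Omega1P da]; apply: u; split=> //=.
- move: hd; rewrite -c1 deg_cmp // db da d1 d2 !add_row_mx !add0r !addr0.
  by move=> /eq_row_mx [_ ->].
- move: hd; rewrite -c1 deg_cmp // db da d1 d2 !add_row_mx !add0r !addr0.
  by move=> /eq_row_mx [-> _].
Qed.

Definition swap p q : Om * Om := projT1 (cid (corner_factorization p q)).

Lemma swapP p q :
  [/\ sr (swap p q).1 = rg (swap p q).2,
      cmp (swap p q).1 (swap p q).2 = corner p q,
      in_Omega2 (swap p q).1 & in_Omega1 (swap p q).2].
Proof. by have [h _] := projT2 (cid (corner_factorization p q)). Qed.

Lemma color_order_basis k (K : kgraph k) (p : gpath (skeleton K)) c :
  c \in color_order p -> is_basis_vector c.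
Proof.
rewrite /color_order; elim: (pedges p) => //= e es IH.
by rewrite inE => /orP [/eqP ->|/IH //]; exact: (svalP e).
Qed.

Lemma swap_deg p q : deg (swap p q).1 = deg (cls2 (psrc p) q) /\
  deg (swap p q).2 = deg (cls1 p (prng q)).
Proof.
have [h1 h2 /in_Omega2P h3 /in_Omega1P h4] := swapP p q.
have [_ _] := corner_ends p q; rewrite -h2 deg_cmp //.
have [_ _ ->] := cls1_ends p (prng q); have [_ _ ->] := cls2_ends (psrc p) q.
by rewrite h3 h4 !add_row_mx !add0r !addr0 => /eq_row_mx [-> ->].
Qed.

Lemma act_left_exists (p : gpath (skeleton L)) (q : gpath (skeleton G)) :
  exists! q' : gpath (skeleton G),
  color_order q' = color_order q /\ cls2 (prng p) q' = (swap p q).1.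
Proof.
have [h1 h2 _ _] := swapP p q; have [d1 _] := swap_deg p q.
have [_ _ d2] := cls2_ends (psrc p) q; rewrite d2 in d1.
have [r _ _] := corner_ends p q; rewrite -h2 rg_cmp // in r.
have [q' [_ hc hq]] := cls2_exists (@color_order_basis _ _ q) d1 r.
exists q'; split=> // q'' [hc' hq']; apply: (@cls2_inj _ _ (prng p)).
  by rewrite hc hc'.
by rewrite hq hq'.
Qed.

Lemma act_right_exists (p : gpath (skeleton L)) (q : gpath (skeleton G)) :
  exists! p' : gpath (skeleton L),
  color_order p' = color_order p /\ cls1 p' (psrc q) = (swap p q).2.
Proof.
have [h1 h2 hO2 _] := swapP p q; have [_ d1] := swap_deg p q.
have [_ _ d2] := cls1_ends p (prng q); rewrite d2 in d1.
have [q' [[hc hq] _]] := act_left_exists p q.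
have [_ s r2] := corner_ends p q; rewrite -h2 sr_cmp // in s.
have [_ s' _] := cls2_ends (prng p) q'; rewrite hq h1 in s'.
have M2 : Omega1_mor (psrc q') (swap p q).2.
  by apply/Omega1_morP; split; [case: (swapP p q) | exists (prng p)].
have ew : psrc q' = psrc q.
  by case: (Omega1_sr M2) => x; rewrite s => /(bij_inj (gvtx_bij phi)) [].
rewrite ew in s'.
have [p' [_ hc' hp']] := cls1_exists (@color_order_basis _ _ p) d1 s'.
exists p'; split=> // p'' [hc'' hp'']; apply: (@cls1_inj _ _ (psrc q)).
  by rewrite hc' hc''.
by rewrite hp' hp''.
Qed.

(* [act_left p q] is p_|>(q) and [act_right q p] is q_<|(p). *)
Definition act_left (p : gpath (skeleton L)) (q : gpath (skeleton G)) :
  gpath (skeleton G) := projT1 (cid (act_left_exists p q)).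
Definition act_right (q : gpath (skeleton G)) (p : gpath (skeleton L)) :
  gpath (skeleton L) := projT1 (cid (act_right_exists p q)).

Lemma act_leftP p q : color_order (act_left p q) = color_order q /\
  cls2 (prng p) (act_left p q) = (swap p q).1.
Proof. by have [h _] := projT2 (cid (act_left_exists p q)). Qed.

Lemma act_rightP p q : color_order (act_right q p) = color_order p /\
  cls1 (act_right q p) (psrc q) = (swap p q).2.
Proof. by have [h _] := projT2 (cid (act_right_exists p q)). Qed.

End QuasiProductSkeleton.

(* The injective functors psi1, psi2 with their degree conditions are understood
   to guarantee that L and G occur, up to isomorphism, among the k-graphs
   Omega_1^w and Omega_2^x; the last two fields make this explicit. *)
Record quasi_product k1 k2 (Om : kgraph (k1 + k2)) (L : kgraph k1)
  (G : kgraph k2) := QuasiProduct {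
  qp_skel : cdigraph_iso (skeleton (prod_kgraph L G)) (skeleton Om);
  qp_psi1 : functor L Om;
  qp_psi2 : functor G Om;
  qp_psi1_inj : injective qp_psi1;
  qp_psi2_inj : injective qp_psi2;
  qp_psi1_deg : forall l : L, deg l = lsubmx (deg (qp_psi1 l));
  qp_psi2_deg : forall g : G, deg g = rsubmx (deg (qp_psi2 g));
  qp_slice1 : exists w0 : obj G, kgraph_isomorphic (Omega1 qp_skel w0) L;
  qp_slice2 : exists x0 : obj L, kgraph_isomorphic (Omega2 qp_skel x0) G
}.

Definition stable k1 k2 (Om : kgraph (k1 + k2)) (L : kgraph k1) (G : kgraph k2)
  (Q : quasi_product Om L G) : Prop :=
  forall p : gpath (skeleton L), act_left (qp_skel Q) p =1 id.

(* Main.v *)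
Require Import Defs.
From mathcomp Require Import all_boot all_algebra.
From mathcomp Require Import boolp.

(** Write v = r(q) and w = s(q). Stability says that every l in Omega_1^v
    slides past q: l (s(l),q) = (r(l),q) m for some m in Omega_1^w, and the
    induced map sends l to m. By unique factorization each of l and m determines
    the other, and pasting two such squares shows that sliding respects
    composition. Every m is reached: rewrite (r(m),q) m as l (s(l),q') with l of
    degree d(m) and q' of the color order of q; by stability l also slides past
    q', and comparing the two factorizations gives q' = q. *)

Set Implicit Arguments.
Unset Strict Implicit.
Unset Printing Implicit Defensive.

Import GRing.Theory.

(** Degrees live in a monoid without negatives, so cancellation is done entrywise. *)
Lemma nat_mx_addrI m n (a : 'M[nat]_(m, n)) : injective (+%R a)%R.
Proof.
move=> b c /matrixP h; apply/matrixP => i j.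
by have /= := h i j; rewrite !mxE => /addnI.
Qed.

(** * Unique factorization and isomorphisms of k-graphs *)

Section KGraph.
Variable k : nat.

(** Equal composites have equal degree, so cancelling [deg a] matches the degrees of the second
    factors; the uniqueness half of the factorization property then applies. *)
Lemma cmp_factor_inj (K : kgraph k) (a b a' b' : K) :
  sr a = rg b -> sr a' = rg b' ->
  deg a = deg a' -> cmp a b = cmp a' b' -> a = a' /\ b = b'.
Proof.
move=> s s' da e.
have db : deg b = deg b'.
  by apply: (@nat_mx_addrI _ _ (deg a)); rewrite -deg_cmp // e da deg_cmp.
have [ab [_ u]] := factorization (deg_cmp s).
have := u (a', b') (And4 s' (esym e) (esym da) (esym db)).
by rewrite (u (a, b) (And4 s erefl erefl erefl)) => -[].
Qed.

(** Builds an isomorphism from its graph [S]. Ranges and sources are tested on identities because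
    objects are identified with them; this also fixes the object map, which sends [v] to the range
    of the image of [idm v]. *)
Lemma kgraph_iso_of_rel (K K' : kgraph k) (S : K -> K' -> Prop) :
    (forall l, exists m, S l m) -> (forall m, exists l, S l m) ->
    (forall l m m', S l m -> S l m' -> m = m') ->
    (forall l l' m, S l m -> S l' m -> l = l') ->
    (forall l m, S l m -> deg m = deg l) ->
    (forall l m, S l m -> S (idm (rg l)) (idm (rg m))) ->
    (forall l m, S l m -> S (idm (sr l)) (idm (sr m))) ->
    (forall l l' m m', sr l = rg l' -> sr m = rg m' -> S l m -> S l' m' ->
       S (cmp l l') (cmp m m')) ->
  exists F : functor K K', is_kgraph_iso F /\ forall l, S l (F l).
Proof.
move=> Stot Ssurj Sfun Sinj Sdeg Srg Ssr Scmp.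
pose f l := projT1 (cid (Stot l)).
have fP l : S l (f l) := projT2 (cid (Stot l)).
pose g m := projT1 (cid (Ssurj m)).
have gP m : S (g m) m := projT2 (cid (Ssurj m)).
have f_rg l : f (idm (rg l)) = idm (rg (f l)) by apply: Sfun (fP _) (Srg _ _ _).
have f_sr l : f (idm (sr l)) = idm (sr (f l)) by apply: Sfun (fP _) (Ssr _ _ _).
have Frg l : rg (f l) = rg (f (idm (rg l))) by rewrite f_rg rg_id.
have Fsr l : sr (f l) = rg (f (idm (sr l))) by rewrite f_sr rg_id.
have Fid v : f (idm v) = idm (rg (f (idm v))).
  by rewrite -f_rg rg_id.
have Fcmp l m : sr l = rg m -> f (cmp l m) = cmp (f l) (f m).
  move=> e; apply: Sfun (fP _) (Scmp _ _ _ _ e _ (fP l) (fP m)).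
  by rewrite Fsr e -Frg.
exists (@Functor K K' (fun v => rg (f (idm v))) f Frg Fsr Fid Fcmp).
split=> //; split=> [|l]; last exact: Sdeg.
by exists g => l; [apply: Sinj (gP _) (fP l) | apply: Sfun (fP _) (gP l)].
Qed.

Lemma kgraph_isomorphic_refl (K : kgraph k) : kgraph_isomorphic K K.
Proof.
have [||||||||F [FI _]] := @kgraph_iso_of_rel K K eq; last by exists F.
- by move=> l; exists l.
- by move=> l; exists l.
- by move=> l m m' <-.
- by move=> l l' m ->.
- by move=> l m ->.
- by move=> l m ->.
- by move=> l m ->.
- by move=> l l' m m' _ _ -> ->.
Qed.

Lemma kgraph_isomorphic_sym (K K' : kgraph k) :
  kgraph_isomorphic K K' -> kgraph_isomorphic K' K.
Proof.
case=> F [[g gK Kg] Fdeg].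
have [||||||||F' [FI _]] := @kgraph_iso_of_rel K' K (fun m l => F l = m);
  last by exists F'.
- by move=> m; exists (g m).
- by move=> l; exists (F l).
- by move=> m l l' <- /(can_inj gK).
- by move=> m m' l <-.
- by move=> m l <-.
- by move=> m l <-; rewrite functor_id functor_rg.
- by move=> m l <-; rewrite functor_id functor_sr.
- by move=> m m' l l' _ e <- <-; rewrite functor_cmp.
Qed.

Lemma kgraph_isomorphic_trans (K1 K2 K3 : kgraph k) :
  kgraph_isomorphic K1 K2 -> kgraph_isomorphic K2 K3 -> kgraph_isomorphic K1 K3.
Proof.
case=> F [[f fK Kf] Fdeg] [H [[h hK Kh] Hdeg]].
have [||||||||F' [FI _]] := @kgraph_iso_of_rel K1 K3 (fun l m => H (F l) = m);
  last by exists F'.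
- by move=> l; exists (H (F l)).
- by move=> m; exists (f (h m)); rewrite Kf Kh.
- by move=> l m m' <-.
- by move=> l l' m <- /(can_inj hK) /(can_inj fK).
- by move=> l m <-; rewrite Hdeg.
- by move=> l m <-; rewrite !functor_id !functor_rg.
- by move=> l m <-; rewrite !functor_id !functor_sr.
- by move=> l l' m m' e _ <- <-; rewrite !functor_cmp // !functor_sr !functor_rg e.
Qed.

End KGraph.

(** * Commuting squares along a path of the second factor *)

Section Slide.
Variables (k1 k2 : nat) (Om : kgraph (k1 + k2)) (L : kgraph k1) (G : kgraph k2).
Variable phi : cdigraph_iso (skeleton (prod_kgraph L G)) (skeleton Om).
Implicit Types (p : gpath (skeleton L)) (q : gpath (skeleton G)) (l m : Om).

Let phi_inj : injective (gvtx phi) := bij_inj (gvtx_bij phi).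

(** Both vertical sides of the square carry the same path [q], over [x] and over [y]. The horizontal
    sides are plain elements of [Om]; membership in the subcategories is tracked separately, which
    keeps subtypes out of the square laws. *)
Variant slide q l m : Prop := Slide x y of
  rg l = gvtx phi (x, prng q) & sr l = gvtx phi (y, prng q) &
  rg m = gvtx phi (x, psrc q) & sr m = gvtx phi (y, psrc q) &
  cmp l (cls2 phi y q) = cmp (cls2 phi x q) m.

Let cls2_rg x q : rg (cls2 phi x q) = gvtx phi (x, prng q).
Proof. by case: (cls2_ends phi x q). Qed.
Let cls2_sr x q : sr (cls2 phi x q) = gvtx phi (x, psrc q).
Proof. by case: (cls2_ends phi x q). Qed.
Let cls2_deg x y q : deg (cls2 phi x q) = deg (cls2 phi y q).
Proof.
by have [_ _ ->] := cls2_ends phi x q; have [_ _ ->] := cls2_ends phi y q.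
Qed.

Lemma slide_deg q l m : slide q l m -> deg m = deg l.
Proof.
case=> x y rl sl rm sm e; apply: (@nat_mx_addrI _ _ (deg (cls2 phi x q))).
rewrite -deg_cmp ?cls2_sr // -e deg_cmp ?cls2_rg //.
by rewrite addrC (cls2_deg y x).
Qed.

Lemma slide_fun q l m m' : slide q l m -> slide q l m' -> m = m'.
Proof.
case=> x y rl sl rm sm e [x' y' rl' sl' rm' sm' e'].
have [ex] : (x, prng q) = (x', prng q) by apply: phi_inj; rewrite -rl.
have [ey] : (y, prng q) = (y', prng q) by apply: phi_inj; rewrite -sl.
move: rm' sm' e'; rewrite -ex -ey e => rm' sm' /cmp_factor_inj [] //.
- by rewrite cls2_sr.
- by rewrite cls2_sr.
Qed.

Lemma slide_inj q l l' m : slide q l m -> slide q l' m -> l = l'.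
Proof.
(* Here the unknown sides are the first factors, so their degrees must be matched, through [m],
   before unique factorization applies. *)
move=> S S'; have dl : deg l = deg l' by rewrite -(slide_deg S) (slide_deg S').
case: S S' => x y rl sl rm sm e [x' y' rl' sl' rm' sm' e'].
have [ex] : (x, psrc q) = (x', psrc q) by apply: phi_inj; rewrite -rm.
have [ey] : (y, psrc q) = (y', psrc q) by apply: phi_inj; rewrite -sm.
move: rl' sl' e'; rewrite -ex -ey -e => rl' sl' /esym/cmp_factor_inj [] //.
- by rewrite cls2_rg.
- by rewrite cls2_rg.
Qed.

Let slide_idm q x :
  slide q (idm (gvtx phi (x, prng q))) (idm (gvtx phi (x, psrc q))).
Proof.
exists x x; rewrite ?rg_id ?sr_id //.
by rewrite -{1}(cls2_rg x q) cmp_idl -(cls2_sr x q) cmp_idr.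
Qed.

Lemma slide_rg q l m : slide q l m -> slide q (idm (rg l)) (idm (rg m)).
Proof. by case=> x y -> _ -> _ _. Qed.

Lemma slide_sr q l m : slide q l m -> slide q (idm (sr l)) (idm (sr m)).
Proof. by case=> x y _ -> _ -> _. Qed.

(** The two squares are pasted along their common vertical side, the element of [q] over [y]. *)
Lemma slide_cmp q l l' m m' : sr l = rg l' -> sr m = rg m' ->
  slide q l m -> slide q l' m' -> slide q (cmp l l') (cmp m m').
Proof.
move=> sl sm [x y rl sl1 rm sm1 e] [y' z rl' sl' rm' sm' e'].
have [ey] : (y, prng q) = (y', prng q) by apply: phi_inj; rewrite -sl1 sl.
subst y'; exists x z; rewrite ?rg_cmp ?sr_cmp //.
rewrite -cmpA ?cls2_rg // e' cmpA ?cls2_rg ?cls2_sr // e.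
by rewrite -cmpA ?cls2_sr.
Qed.

(** * Squares provided by stability, and the induced isomorphism *)

Hypothesis stab : forall p, act_left phi p =1 id.

(** The square is the factorization defining both actions; stability turns its left side, a priori
    carrying [act_left phi p q], into one carrying [q]. *)
Lemma slide_act_right p q :
  slide q (cls1 phi p (prng q)) (cls1 phi (act_right phi q p) (psrc q)).
Proof.
have [sw cw _ _] := swapP phi p q.
have [_ aL] := act_leftP phi p q; have [_ aR] := act_rightP phi p q.
have [rl sl _] := cls1_ends phi p (prng q).
have [rc sc _] := corner_ends phi p q.
rewrite stab in aL.
exists (prng p) (psrc p) => //.
- by rewrite aR -sw -aL cls2_sr.
- by rewrite aR -sc -cw sr_cmp.
- by rewrite aL aR cw.
Qed.

Lemma slide_total q l : Omega1_mor phi (prng q) l ->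
  exists2 m, Omega1_mor phi (psrc q) m & slide q l m.
Proof.
case=> p <-; exists (cls1 phi (act_right phi q p) (psrc q)).
  by exists (act_right phi q p).
exact: slide_act_right.
Qed.

Lemma slide_surj q m : Omega1_mor phi (psrc q) m ->
  exists2 l, Omega1_mor phi (prng q) l & slide q l m.
Proof.
case=> p <-; set m0 := cls1 phi p _; pose x := prng p.
have [rm sm dm] := cls1_ends phi p (psrc q); rewrite -/m0 in rm sm dm.
have sm' : sr (cls2 phi x q) = rg m0 by rewrite cls2_sr.
have := deg_cmp sm'; rewrite addrC => /factorization [[a b] [[/= sa ca da db] _]].
have ra : rg a = gvtx phi (x, prng q).
  by rewrite -(rg_cmp sa) ca rg_cmp // cls2_rg.
have [p' ep'] : Omega1_mor phi (prng q) a.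
  by apply/Omega1_morP; split; [rewrite /in_Omega1 da dm row_mxKr | exists x].
have [ra' sa' _] := cls1_ends phi p' (prng q); rewrite ep' in ra' sa'.
have [_ _ d2] := cls2_ends phi x q; rewrite d2 in db.
(* The color order of [q] is imposed on [q']: an element determines its representing path only once
   the color order is fixed. *)
have [q' [rq' cq' eb]] :=
  cls2_exists (@color_order_basis _ _ q) db (etrans (esym sa) sa').
have [ex] : (x, prng q) = (prng p', prng q) by apply: phi_inj; rewrite -ra.
have := slide_act_right p' q'; rewrite rq' ep' => S.
case: (S) => x' y'; rewrite rq' => ra2 sa2 rm2 sm2 e2.
have [ex'] : (x, prng q) = (x', prng q) by apply: phi_inj; rewrite -ra.
have [ey'] : (psrc p', prng q) = (y', prng q) by apply: phi_inj; rewrite -sa'.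
subst x' y'; rewrite eb ca in e2.
(* Two factorizations of the same element are compared: [e3] will give [q' = q], and [e4] identifies
   [m0] as the element to which [a] slides. *)
have [||e3 e4] := cmp_factor_inj sm' _ _ e2.
- by rewrite cls2_sr.
- have [_ _ ->] := cls2_ends phi x q; have [_ _ ->] := cls2_ends phi x q'.
  by rewrite cq'.
have eq' : q' = q by apply: (@cls2_inj _ _ _ _ _ phi _ _ x).
exists a; first by exists p'.
by rewrite e4; move: S; rewrite eq'.
Qed.

Lemma induced_isomorphism q :
  exists F : functor (Omega1 phi (prng q)) (Omega1 phi (psrc q)),
    is_kgraph_iso F /\ forall p,
      F (class1 phi p (prng q)) = class1 phi (act_right phi q p) (psrc q).
Proof.
pose S (l : Omega1 phi (prng q)) (m : Omega1 phi (psrc q)) :=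
  slide q (sval l) (sval m).
have [||||||||F [FI FS]] := @kgraph_iso_of_rel _ _ _ S.
- case=> l hl; have [m hm lm] := slide_total hl.
  by exists (exist _ m hm).
- case=> m hm; have [l hl lm] := slide_surj hm.
  by exists (exist _ l hl).
- by move=> l m m' lm lm'; apply: sig_inj; apply: slide_fun lm lm'.
- by move=> l l' m lm l'm; apply: sig_inj; apply: slide_inj lm l'm.
- by move=> l m /slide_deg /= ->.
- by move=> l m /slide_rg.
- by move=> l m /slide_sr.
- move=> l l' m m' [sl] [sm] lm l'm'; rewrite /S /= !sub_cmpE //.
  exact: slide_cmp.
exists F; split=> // p; apply: sig_inj.
(* Both sides are slides of the same element along [q]; in particular the class of
   [act_right phi q p] depends only on that of [p]. *)
exact: slide_fun (FS (class1 phi p (prng q))) (slide_act_right p q).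
Qed.

Lemma edge_isomorphism (e : edge (skeleton G)) :
  kgraph_isomorphic (Omega1 phi (erng e)) (Omega1 phi (esrc e)).
Proof.
have ve : @is_path _ (skeleton G) (erng e) [:: e] by [].
by have [F [FI _]] := induced_isomorphism (GPath ve); exists F.
Qed.

(** Induction on an undirected walk: an edge traversed backwards contributes the inverse
    isomorphism. *)
Lemma connected_isomorphism (v w : obj G) : connected G ->
  kgraph_isomorphic (Omega1 phi v) (Omega1 phi w).
Proof.
move=> /(_ v w); elim=> {v w} [v w [e [<- <-]]|v|v w _|u v w _ IH1 _ IH2].
- exact: edge_isomorphism.
- exact: kgraph_isomorphic_refl.
- exact: kgraph_isomorphic_sym.
- exact: kgraph_isomorphic_trans IH1 IH2.
Qed.

End Slide.

Theorem theorem3p12 (k1 k2 : nat) (Om : kgraph (k1 + k2)) (L : kgraph k1)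
  (G : kgraph k2) (Q : quasi_product Om L G)
  (Om_row_finite : row_finite Om) (G_stable : stable Q) :
  (forall q : gpath (skeleton G),
     exists F : functor (Omega1 (qp_skel Q) (prng q))
                        (Omega1 (qp_skel Q) (psrc q)),
       is_kgraph_iso F /\
       forall p : gpath (skeleton L),
         F (class1 (qp_skel Q) p (prng q)) =
         class1 (qp_skel Q) (act_right (qp_skel Q) q p) (psrc q)) /\
  (connected G ->
     forall v w : obj G,
       kgraph_isomorphic (Omega1 (qp_skel Q) v) (Omega1 (qp_skel Q) w) /\
       kgraph_isomorphic (Omega1 (qp_skel Q) w) L).
Proof.
split=> [q|Gc v w]; first exact: induced_isomorphism.
split; first exact: connected_isomorphism.
(* One vertex [w0] already carries a copy of [L], and connectedness transports it to every [w]. *)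
have [w0 hw0] := qp_slice1 Q.
by apply: kgraph_isomorphic_trans hw0; apply: connected_isomorphism.
Qed.
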